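(* Let $\mathcal{G}_1$ and $\mathcal{G}_2$ be two maximal ancestral graphs (MAGs) on the same vertex set $\mathcal{V}$. Then $\mathcal{G}_1$ and $\mathcal{G}_2$ are Markov equivalent if and only if $\mathcal{S}(\mathcal{G}_1)=\mathcal{S}(\mathcal{G}_2)$.
   Context: An acyclic directed mixed graph (ADMG) $\mathcal{G}$ on a finite vertex set $\mathcal{V}$ has edges of two kinds, directed ($a\to b$) and bidirected ($a\leftrightarrow b$), and has no directed cycle. For $v\in\mathcal{V}$: $\mathrm{pa}_{\mathcal{G}}(v)=\{w: w\to v\}$; $\mathrm{sib}_{\mathcal{G}}(v)=\{w: w\leftrightarrow v\}$; $\mathrm{an}_{\mathcal{G}}(v)$ is $v$ together with all $w$ having a directed path $w\to\cdots\to v$; $\mathrm{de}_{\mathcal{G}}(v)$ is $v$ together with all $w$ having a directed path $v\to\cdots\to w$; $\mathrm{dis}_{\mathcal{G}}(v)$ (the district of $v$) is $v$ together with all $w$ joined to $v$ by a path consisting only of bidirected edges. For a set $W$ these operators are the union over $w\in W$. For $W\subseteq\mathcal{V}$, $\mathcal{G}_W$ is the induced subgraph on $W$ and $\mathrm{dis}_W(v)$ denotes the district of $v$ in $\mathcal{G}_W$ (union over elements for sets). A path is a sequence of distinct vertices in which consecutive vertices are joined by an edge. A non-endpoint vertex $w$ of a path is a collider on it if both path edges at $w$ have an arrowhead at $w$ (each is $\to w$ or $\leftrightarrow w$); otherwise it is a noncollider. For vertices $a,b$ and a set $C$ with $a,b\notin C$, a path between $a$ and $b$ is m-connecting given $C$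 if every noncollider on it is not in $C$ and every collider on it is in $\mathrm{an}_{\mathcal{G}}(C)$. For disjoint sets $A,B,C$ with $A,B$ nonempty, $A$ and $B$ are m-separated by $C$ if there is no m-connecting path given $C$ between any $a\in A$ and $b\in B$. Two vertices are adjacent if joined by an edge. $\mathcal{G}$ is maximal if every pair of nonadjacent vertices is m-separated by some set; it is ancestral if $\mathrm{sib}_{\mathcal{G}}(v)\cap\mathrm{an}_{\mathcal{G}}(v)=\emptyset$ for all $v$. A MAG is a maximal ancestral ADMG. Two graphs on the same vertex set are Markov equivalent if exactly the same m-separation statements hold in both. For $W\subseteq\mathcal{V}$, $\mathrm{barren}_{\mathcal{G}}(W)=\{w\in W:\mathrm{de}_{\mathcal{G}}(w)\cap W=\{w\}\}$. A set $H\subseteq\mathcal{V}$ is a head if $\mathrm{barren}_{\mathcal{G}}(H)=H$ and $H$ is contained in a single district of $\mathcal{G}_{\mathrm{an}_{\mathcal{G}}(H)}$; $\mathcal{H}(\mathcal{G})$ is the set of heads. The tail of a head is $\mathrm{tail}(H)=(\mathrm{dis}_{\mathrm{an}(H)}(H)\setminus H)\cup\mathrm{pa}_{\mathcal{G}}(\mathrm{dis}_{\mathrm{an}(H)}(H))$, where $\mathrm{an}(H)=\mathrm{an}_{\mathcal{G}}(H)$. The parametrizing set is $\mathcal{S}(\mathcal{G})=\{H\cup A: H\in\mathcal{H}(\mathcal{G}),\ A\subseteq\mathrm{tail}(H)\}$. *)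

(* Defs.v *)
From mathcomp Require Import all_boot.

Set Implicit Arguments.
Unset Strict Implicit.
Unset Printing Implicit Defensive.

(* No constraint is imposed here; in particular x -> y and x <-> y may hold
   simultaneously, as is allowed in an ADMG. *)
Record mixed_graph (V : finType) := MixedGraph {
  dir : rel V;   (* dir G x y : x -> y *)
  bidir : rel V  (* bidir G x y : x <-> y *)
}.

Definition acyclic (V : finType) (G : mixed_graph V) : Prop :=
  forall x y : V, dir G x y -> ~~ connect (dir G) y x.

Definition is_admg (V : finType) (G : mixed_graph V) : Prop :=
  [/\ symmetric (bidir G), irreflexive (bidir G) & acyclic G].

Section Operators.
Variables (V : finType) (G : mixed_graph V).
Implicit Types (v w : V) (W : {set V}).

Definition pa v : {set V} := [set w | dir G w v].
Definition sib v : {set V} := [set w | bidir G w v].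
Definition an v : {set V} := [set w | connect (dir G) w v].
Definition de v : {set V} := [set w | connect (dir G) v w].
Definition dis v : {set V} := [set w | connect (bidir G) v w].

Definition pa_set W : {set V} := \bigcup_(w in W) pa w.
Definition an_set W : {set V} := \bigcup_(w in W) an w.
Definition dis_set W : {set V} := \bigcup_(w in W) dis w.

Definition adjacent v w : bool := [|| dir G v w, dir G w v | bidir G v w].

(* The induced subgraph is kept on the ambient type: the vertices outside W
   become isolated, and vertex sets computed in it are to be cut down to W. *)
Definition induced W : mixed_graph V :=
  MixedGraph [rel x y | [&& x \in W, y \in W & dir G x y]]
             [rel x y | [&& x \in W, y \in W & bidir G x y]].

End Operators.

Definition dis_in (V : finType) (G : mixed_graph V) (W X : {set V}) : {set V} :=
  W :&: dis_set (induced G W) X.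

(* Two vertices can be joined by edges of different kinds, so a path records
   the edge used at each step: the list [:: (k1, x1); ...; (kn, xn)] based at x
   stands for  x k1 x1 k2 ... kn xn. *)
Inductive edge_kind := Fwd (* -> *) | Bwd (* <- *) | Bi (* <-> *).

Definition head_at_left (k : edge_kind) : bool :=
  match k with Fwd => false | Bwd | Bi => true end.

Definition head_at_right (k : edge_kind) : bool :=
  match k with Bwd => false | Fwd | Bi => true end.

Section Separation.
Variables (V : finType) (G : mixed_graph V).

Definition joined (x : V) (k : edge_kind) (y : V) : bool :=
  match k with
  | Fwd => dir G x y
  | Bwd => dir G y x
  | Bi => bidir G x y
  end.

Fixpoint is_walk (x : V) (p : seq (edge_kind * V)) : bool :=
  if p is (k, y) :: q then joined x k y && is_walk y q else true.

Definition is_path (a b : V) (p : seq (edge_kind * V)) : bool :=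
  [&& is_walk a p, uniq (a :: unzip2 p) & last a (unzip2 p) == b].

(* w runs over the non-endpoint vertices, with k and k' the path edges
   preceding and following it. *)
Fixpoint is_open (C : {set V}) (p : seq (edge_kind * V)) : bool :=
  if p is (k, w) :: q then
    if q is (k', _) :: _ then
      (if head_at_right k && head_at_left k' then w \in an_set G C
       else w \notin C) && is_open C q
    else true
  else true.

Definition m_connecting (C : {set V}) (a b : V) (p : seq (edge_kind * V)) : bool :=
  is_path a b p && is_open C p.

Definition m_separated (A B C : {set V}) : Prop :=
  [/\ A != set0, B != set0,
      [&& [disjoint A & B], [disjoint A & C] & [disjoint B & C]]
    & forall a b : V, a \in A -> b \in B ->
        ~ exists p : seq (edge_kind * V), m_connecting C a b p].

Definition is_maximal : Prop :=
  forall a b : V, a != b -> ~~ adjacent G a b ->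
    exists C : {set V}, m_separated [set a] [set b] C.

Definition is_ancestral : Prop :=
  forall v : V, sib G v :&: an G v = set0.

Definition is_mag : Prop := [/\ is_admg G, is_maximal & is_ancestral].

End Separation.

Definition markov_equivalent (V : finType) (G1 G2 : mixed_graph V) : Prop :=
  forall A B C : {set V}, m_separated G1 A B C <-> m_separated G2 A B C.

Section ParametrizingSet.
Variables (V : finType) (G : mixed_graph V).
Implicit Types (H W : {set V}).

Definition barren W : {set V} := [set w in W | de G w :&: W == [set w]].

(* The empty set is not a head: the graph induced on its ancestors has no
   district. *)
Definition is_head H : bool :=
  (barren H == H) &&
  [exists v in an_set G H, H \subset dis_in G (an_set G H) [set v]].

Definition heads : {set {set V}} := [set H | is_head H].

Definition tail H : {set V} :=
  (dis_in G (an_set G H) H :\: H) :|: pa_set G (dis_in G (an_set G H) H).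

Definition parametrizing_set : {set {set V}} :=
  [set H :|: A | H in heads, A in powerset (tail H)].

End ParametrizingSet.

(* Main.v *)
(* Say that x and y are connected with noncolliders in N and colliders in K if
   some walk between them has all its noncolliders in N and all its colliders in
   K.  For any ADMG, a nonempty W lies in S(G) iff any two of its vertices are
   connected with no noncollider and with colliders in an(W), and a, b are
   m-connected given C iff they are connected with noncolliders outside C and
   colliders in an(C + a + b).  Hence W is in S(G) iff no two a, b in W are
   m-separated by a set containing W - {a, b}, so that S(G) is determined by the
   m-separations.

   Conversely let S(G1) = S(G2) = S, and let U be ancestral in G1.  If any two
   vertices of a set W in U are connected in G2 with noncolliders outside U and
   colliders in an_2(W), then W is in S.  This goes by downward induction on U:
   add to U a vertex v without G1-children in U + v.  Then the members of S
   between {v} and U + v are closed under union (a property of G1), and if v is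
   used as a noncollider of G2, this yields a set Y in S with
   W + v <= Y <= an_2(W); the vertices of Y outside W have descendants in W and
   may be dropped.  Finally, cut a walk of G2 that is m-connecting given C at its
   noncolliders in U = an_1(C + a + b): each piece gives a member of S inside U,
   hence a collider walk of G1 inside U, and these concatenate to an m-connecting
   walk of G1. *)

Require Import Defs.
From mathcomp Require Import all_boot.
From Stdlib Require Import Classical_Prop.

Set Implicit Arguments.
Unset Strict Implicit.
Unset Printing Implicit Defensive.

(* The booleans tell whether the first and the last edge have an arrowhead at the
   respective end of the walk.  Walks are closed under concatenation at any
   vertex rather than built edge by edge, so that reversal and splitting are
   direct inductions. *)
Inductive connection (V : finType) (G : mixed_graph V) (N K : {set V}) :
    bool -> bool -> V -> V -> Prop :=
| ConnEdge x k y of joined G x k y :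
    connection G N K (head_at_left k) (head_at_right k) x y
| ConnCat s t s' t' x y z of connection G N K s t x y
    & connection G N K s' t' y z & y \in (if t && s' then K else N) :
    connection G N K s t' x z.

Definition connected (V : finType) (G : mixed_graph V) (N K : {set V}) x y :=
  exists s t, connection G N K s t x y.

Definition pairwise_connected (V : finType) (G : mixed_graph V)
    (U W : {set V}) :=
  forall a b, a \in W -> b \in W -> a != b ->
    connected G (~: U) (an_set G W) a b.

Section Ancestors.
Variables (V : finType) (G : mixed_graph V).
Implicit Types (x y z : V) (W T : {set V}).

Lemma anP W x :
  reflect (exists2 w, w \in W & connect (dir G) x w) (x \in an_set G W).
Proof.
apply: (iffP bigcupP) => -[w wW h]; exists w => //; by rewrite inE in h *.
Qed.

Lemma sub_an W : W \subset an_set G W.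
Proof. by apply/subsetP=> w wW; apply/anP; exists w. Qed.

Lemma an_connect W x y : connect (dir G) x y -> y \in an_set G W ->
  x \in an_set G W.
Proof.
by move=> xy /anP[w wW yw]; apply/anP; exists w => //; apply: connect_trans yw.
Qed.

Lemma an_sub (A B : {set V}) : A \subset an_set G B -> an_set G A \subset an_set G B.
Proof.
move=> /subsetP AB; apply/subsetP=> x /anP[w wA xw].
exact: an_connect xw (AB _ wA).
Qed.

Lemma anS (A B : {set V}) : A \subset B -> an_set G A \subset an_set G B.
Proof. by move=> AB; apply/an_sub/(subset_trans AB)/sub_an. Qed.

Lemma an_an W : an_set G (an_set G W) \subset an_set G W.
Proof. exact: an_sub. Qed.

Lemma ancestral_connect T x y : an_set G T \subset T ->
  connect (dir G) x y -> y \in T -> x \in T.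
Proof.
move=> /subsetP TT xy yT; apply/TT/(an_connect xy).
exact: (subsetP (sub_an T)).
Qed.

Hypothesis acycG : acyclic G.

Lemma connect_antisym x y :
  connect (dir G) x y -> connect (dir G) y x -> x = y.
Proof.
case/connectP=> -[|z p] /= => [_ -> //|/andP[xz zp] yE] yx.
have zy : connect (dir G) z y by apply/connectP; exists p.
by have := acycG xz; rewrite (connect_trans zy yx).
Qed.

Lemma dir_irrefl x : dir G x x = false.
Proof. by apply/negP=> /[dup] /acycG; rewrite connect0. Qed.

Lemma barrenP W h : reflect
  (h \in W /\ forall x, x \in W -> connect (dir G) h x -> x = h)
  (h \in barren G W).
Proof.
rewrite inE; apply: (iffP andP) => -[hW].
  move=> /eqP/setP deh; split=> // x xW hx.
  by have := deh x; rewrite !inE xW hx => /esym/eqP.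
move=> deh; split=> //; apply/eqP/setP=> x; rewrite !inE.
apply/andP/eqP=> [[hx xW]|->]; [exact: deh|by rewrite connect0].
Qed.

Lemma exists_barren W w : w \in W ->
  exists2 h, h \in barren G W & connect (dir G) w h.
Proof.
move=> wW; pose D := [pred h | (h \in W) && connect (dir G) w h].
have Dw : D w by rewrite /= wW connect0.
case: (arg_minnP (fun h => #|de G h|) Dw) => h /andP[hW wh] hmin.
exists h => //; apply/barrenP; split=> // x xW hx.
have /hmin : D x by rewrite /= xW (connect_trans wh hx).
have sub : de G x \subset de G h.
  by apply/subsetP=> y; rewrite !inE; apply: connect_trans.
rewrite leqNgt => hle; apply: connect_antisym => //.
have : h \in de G x; last by rewrite inE.
apply/negPn/negP=> hx'; case/negP: hle; apply/proper_card/properP; split=> //.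
by exists h; rewrite // inE connect0.
Qed.

Lemma an_barren W : an_set G (barren G W) = an_set G W.
Proof.
apply/eqP; rewrite eqEsubset anS /=; last first.
  by apply/subsetP=> x /barrenP[].
apply/an_sub/subsetP=> w /exists_barren[h hB wh].
by apply/anP; exists h.
Qed.

Lemma barren_no_child W h z : h \in barren G W -> dir G h z ->
  z \notin an_set G W.
Proof.
move=> /barrenP[hW deh] hz; apply/negP=> /anP[w wW zw].
have wh : w = h by apply/deh/(connect_trans (connect1 hz)).
by have := acycG hz; rewrite -wh zw.
Qed.

End Ancestors.

Section Connections.
Variables (V : finType) (G : mixed_graph V).
Hypothesis symG : symmetric (bidir G).
Implicit Types (x y z v : V) (N K T U W : {set V}).

Lemma connection_sub N K N' K' s t x y : N \subset N' -> K \subset K' ->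
  connection G N K s t x y -> connection G N' K' s t x y.
Proof.
move=> /subsetP NN /subsetP KK; elim=> {s t x y}[x k y|]; first exact: ConnEdge.
move=> s t s' t' x y z _ c1 _ c2 yNK; apply: (ConnCat c1 c2).
by case: (t && s') yNK; [apply: KK|apply: NN].
Qed.

Lemma connected_sub N K N' K' x y : N \subset N' -> K \subset K' ->
  connected G N K x y -> connected G N' K' x y.
Proof. by move=> h h' [s [t c]]; exists s, t; apply: connection_sub c. Qed.

Lemma connection_sym N K s t x y :
  connection G N K s t x y -> connection G N K t s y x.
Proof.
elim=> {s t x y}[x k y|s t s' t' x y z _ c1 _ c2 yNK].
  case: k => /= xy; [apply: (@ConnEdge _ _ _ _ _ Bwd)|
    apply: (@ConnEdge _ _ _ _ _ Fwd)|apply: (@ConnEdge _ _ _ _ _ Bi)] => //=.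
  by rewrite symG.
by apply: (ConnCat c2 c1); rewrite andbC.
Qed.

Lemma connected_sym N K x y : connected G N K x y -> connected G N K y x.
Proof. by move=> [s [t c]]; exists t, s; apply: connection_sym. Qed.

Lemma connected_cat N K x y z : y \in N -> y \in K ->
  connected G N K x y -> connected G N K y z -> connected G N K x z.
Proof.
move=> yN yK [s [t c1]] [s' [t' c2]]; exists s, t'.
by apply: (ConnCat c1 c2); case: ifP.
Qed.

(* A walk leaving x through a tail is directed until its first collider or its
   end. *)
Lemma connection_tail_an N K t x y : connection G N K false t x y ->
  x \in an_set G K \/ t /\ connect (dir G) x y.
Proof.
move: {1 3}false (erefl false) => s s0 c; move: s0.
elim: c => {s t x y}[x [] y //= xy _|]; first by right; rewrite connect1.
move=> s t s' t' x y z _ IH1 _ IH2 yNK /IH1[|[tT xy]]; first by left.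
case: s' IH2 yNK => [_|/(_ erefl) IH2 _].
  by rewrite tT /= => yK; left; apply/anP; exists y.
case: IH2 => [yK|[-> yz]]; first by left; apply: an_connect yK.
by right; rewrite (connect_trans xy yz).
Qed.

Lemma connection_ancestral N K T s t x y : an_set G T \subset T ->
  K \subset T -> x \in T -> y \in T ->
  connection G N K s t x y -> connection G (N :&: T) K s t x y.
Proof.
move=> TT KT xT yT c; elim: c xT yT => {s t x y}[x k y xy _ _|].
  exact: ConnEdge.
move=> s t s' t' x y z c1 IH1 c2 IH2 yNK xT zT.
have follow u w r r' : u \in T -> connection G N K r r' w u -> ~~ r -> w \in T.
  move=> uT c /negPf r0; rewrite r0 in c.
  case: (connection_tail_an c) => [wK|[_ wu]].
    exact: (subsetP (subset_trans (anS G KT) TT)).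
  exact: ancestral_connect TT wu uT.
have yT : y \in T.
  move: yNK; case: ifP => [_ /(subsetP KT) //|/negbT].
  rewrite negb_and => /orP[nt _|ns _]; last exact: follow c2 ns.
  exact: follow xT (connection_sym c1) nt.
apply: (ConnCat (IH1 xT yT) (IH2 yT zT)).
by move: yNK; case: ifP => // _ yN; rewrite inE yN.
Qed.

Lemma connection_end_tail N K T s x y : N \subset T -> K \subset T ->
  x \in T -> connection G N K s false x y -> exists2 z, z \in T & dir G y z.
Proof.
move=> NT KT xT; move: {1 3}false (erefl false) => t t0 c; move: t0 xT.
elim: c => {s t x y}[x [] y //= yx _|]; first by exists x.
move=> s t s' t' x y z _ _ _ IH2 yNK t0 _; apply: IH2 => //.
by case: ifP yNK => _; [apply: (subsetP KT)|apply: (subsetP NT)].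
Qed.

Lemma connection_split N K v s t x y : connection G (v |: N) K s t x y ->
  connection G N K s t x y \/
  (exists t', connection G N K s t' x v) /\
  (exists s', connection G N K s' t v y).
Proof.
elim=> {s t x y}[x k y xy|s t s' t' x y z _ IH1 _ IH2 yNK].
  by left; apply: ConnEdge.
have {yNK}[yNK|yv] : y \in (if t && s' then K else N) \/ y = v.
  by case: ifP yNK => _; [left|rewrite in_setU1 => /orP[/eqP|]; [right|left]].
- case: IH1 => [c1|[[u1 l1] [u2 r1]]]; case: IH2 => [c2|[[u3 l2] [u4 r2]]].
  + by left; apply: (ConnCat c1 c2).
  + by right; split; [exists u3; apply: (ConnCat c1 l2)|exists u4].
  + by right; split; [exists u1|exists u2; apply: (ConnCat r1 c2)].
  + by right; split; [exists u1|exists u4].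
- rewrite yv in IH1 IH2; right; split.
    by case: IH1 => [c|[]//]; exists t.
  by case: IH2 => [c|[]//]; exists s'.
Qed.

Lemma connected_split N K v x y : connected G (v |: N) K x y ->
  connected G N K x y \/ connected G N K x v /\ connected G N K v y.
Proof.
move=> [s [t /connection_split[c|[[t' c] [s' c']]]]]; [left|right; split].
- by exists s, t.
- by exists s, t'.
- by exists s', t.
Qed.

Lemma connection_directed N x y : connect (dir G) x y -> x \in N ->
  y \notin N -> exists u,
    [/\ u \notin N, connect (dir G) u y & connection G N set0 false true x u].
Proof.
case/connectP=> p + ->; elim: p x => [|z p IH] x /=; first by move=> _ ->.
move=> /andP[xz zp] xN yN; case: (boolP (z \in N)) => zN.
  have [u [uN uy c]] := IH _ zp zN yN; exists u; split=> //.
  by apply: (ConnCat (@ConnEdge _ _ _ _ _ Fwd _ xz) c); rewrite /= zN.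
exists z; split=> //; first by apply/connectP; exists p.
exact: (@ConnEdge _ _ _ _ _ Fwd).
Qed.

(* A collider outside U is replaced by a detour to its first descendant in U
   and back, on which it is a noncollider. *)
Lemma connection_visible_colliders U W s t x y : W \subset U ->
  connection G (~: U) (an_set G W) s t x y ->
  connection G (~: U) (U :&: an_set G W) s t x y.
Proof.
move=> /subsetP WU; elim=> {s t x y}[x k y xy|]; first exact: ConnEdge.
move=> s t s' t' x y z _ c1 _ c2.
case: ifP => [/andP[tT s'T] yK|ts yN]; last first.
  by apply: (ConnCat c1 c2); rewrite ts.
case: (boolP (y \in U)) => yU.
  by apply: (ConnCat c1 c2); rewrite tT s'T /= inE yU.
have [w wW yw] := anP _ _ _ yK.
have yN : y \in ~: U by rewrite inE.
have wN : w \notin ~: U by rewrite inE negbK WU.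
have [u [uN uw cu]] := connection_directed yw yN wN.
have {}cu := connection_sub (subxx (~: U)) (sub0set (U :&: an_set G W)) cu.
have uK : u \in U :&: an_set G W.
  by rewrite inE in uN; rewrite inE -(negbK (u \in U)) uN; apply/anP; exists w.
have c3 := ConnCat cu (connection_sym cu) uK.
have c4 : connection G (~: U) (U :&: an_set G W) s false x y.
  by apply: (ConnCat c1 c3); rewrite andbF.
by apply: (ConnCat c4 c2).
Qed.

Lemma connection_collider_set N K s t x y : connection G N K s t x y ->
  exists Y : {set V},
  [/\ Y \subset K, connection G N Y s t x y,
      forall u, u \in Y -> connection G N Y s true x u,
      forall u, u \in Y -> connection G N Y true t u y &
      forall u u', u \in Y -> u' \in Y -> u != u' ->
        connection G N Y true true u u'].
Proof.
elim=> {s t x y}[x k y xy|].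
  exists set0; split; rewrite ?sub0set //; try by move=> u; rewrite inE.
  exact: ConnEdge.
move=> s t s' t' x y z _ [Y1 [Y1K c1 l1 r1 m1]] _ [Y2 [Y2K c2 l2 r2 m2]] yNK.
pose Y3 := if t && s' then [set y] else set0.
pose Y := Y3 :|: (Y1 :|: Y2).
have Y1Y : Y1 \subset Y by rewrite /Y setUCA subsetUl.
have Y2Y : Y2 \subset Y by rewrite /Y setUA subsetUr.
have up1 s1 t1 a b : connection G N Y1 s1 t1 a b -> connection G N Y s1 t1 a b.
  exact: connection_sub.
have up2 s1 t1 a b : connection G N Y2 s1 t1 a b -> connection G N Y s1 t1 a b.
  exact: connection_sub.
have yNY : y \in (if t && s' then Y else N).
  by rewrite /Y /Y3; move: yNK; case: ifP => // _ _; rewrite !inE eqxx.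
have cat s1 t1 a b : connection G N Y s1 t a y -> connection G N Y s' t1 y b ->
  connection G N Y s1 t1 a b by move=> c c'; apply: (ConnCat c c').
have inY u : u \in Y -> [\/ [/\ u = y, t = true & s' = true], u \in Y1 | u \in Y2].
  rewrite /Y /Y3 !in_setU => /or3P[|->|->]; last 2 first.
  - by constructor 2.
  - by constructor 3.
  by case: ifP => [/andP[-> ->] /set1P ->|_]; rewrite ?inE //; constructor 1.
exists Y; split.
- rewrite /Y !subUset Y1K Y2K !andbT /Y3.
  by case: ifP yNK => _; rewrite ?sub0set // sub1set.
- exact: cat (up1 _ _ _ _ c1) (up2 _ _ _ _ c2).
- move=> u /inY[[-> tT _]|uY|uY]; first by rewrite -tT; apply: up1.
    by apply/up1/l1.
  exact: cat (up1 _ _ _ _ c1) (up2 _ _ _ _ (l2 _ uY)).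
- move=> u /inY[[-> _ sT]|uY|uY]; first by rewrite -sT; apply: up2.
    exact: cat (up1 _ _ _ _ (r1 _ uY)) (up2 _ _ _ _ c2).
  by apply/up2/r2.
- move=> u u' /inY[[-> tT sT]|uY|uY] /inY[[-> tT' sT']|uY'|uY'] neq.
  + by rewrite eqxx in neq.
  + by apply: connection_sym; rewrite -{2}tT; apply/up1/r1.
  + by rewrite -{1}sT; apply/up2/l2.
  + by rewrite -{2}tT'; apply/up1/r1.
  + by apply/up1/m1.
  + exact: cat (up1 _ _ _ _ (r1 _ uY)) (up2 _ _ _ _ (l2 _ uY')).
  + by apply: connection_sym; rewrite -{1}sT'; apply/up2/l2.
  + apply: connection_sym.
    exact: cat (up1 _ _ _ _ (r1 _ uY')) (up2 _ _ _ _ (l2 _ uY)).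
  + by apply/up2/m2.
Qed.

Lemma connected_in_pairwise_connected U W x y : W \subset U -> x \in U ->
  y \in U -> connected G (~: U) (an_set G W) x y ->
  exists Y : {set V}, [/\ x \in Y, y \in Y, Y \subset U,
    Y \subset [set x; y] :|: an_set G W & pairwise_connected G U Y].
Proof.
move=> WU xU yU [s [t /(connection_visible_colliders WU)]].
case/connection_collider_set=> Y [YK c l r m]; exists ([set x; y] :|: Y).
have up s1 t1 a b : connection G (~: U) Y s1 t1 a b ->
  connected G (~: U) (an_set G ([set x; y] :|: Y)) a b.
  move=> c'; exists s1, t1; apply: connection_sub c' => //.
  exact: subset_trans (subsetUr _ _) (sub_an _ _).
split; rewrite ?inE ?eqxx ?orbT //.
- rewrite !subUset !sub1set xU yU /=; apply: subset_trans YK _.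
  exact: subsetIl.
- by apply/setUS/(subset_trans YK)/subsetIr.
move=> a b; rewrite !inE => /orP[/orP[]/eqP->|aY] /orP[/orP[]/eqP->|bY] neq.
- by rewrite eqxx in neq.
- exact: up c.
- exact: up (l _ bY).
- exact: up (connection_sym c).
- by rewrite eqxx in neq.
- exact: up (connection_sym (r _ bY)).
- exact: up (connection_sym (l _ aY)).
- exact: up (r _ aY).
- exact: up (m _ _ aY bY neq).
Qed.

End Connections.

Section ParametrizingSetConnections.
Variables (V : finType) (G : mixed_graph V).
Hypothesis admgG : is_admg G.
Implicit Types (x y z v : V) (H K W X Y Z : {set V}).

Let symG : symmetric (bidir G). Proof. by case: admgG. Qed.
Let acycG : acyclic G. Proof. by case: admgG. Qed.

Lemma induced_connect_sym K : connect_sym (bidir (induced G K)).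
Proof. by apply: sym_connect_sym => x y /=; rewrite symG andbCA. Qed.

Lemma collider_connection_district K s t x y : x \in K -> y \in K ->
  connection G set0 K s t x y -> exists d e,
  [/\ d \in K, e \in K, (if s then d == x else dir G x d),
      (if t then e == y else dir G y e) & connect (bidir (induced G K)) d e].
Proof.
move=> + + c; elim: c => {s t x y}[x k y|s t s' t' x y z _ IH1 _ IH2 yK xK zK].
  case: k => /= xy xK yK; [exists y, y|exists x, x|exists x, y];
    by split=> //; rewrite ?connect0 // connect1 //= xK yK.
move: yK IH1 IH2; case: t; case: s' => //=; rewrite ?inE // => yK IH1 IH2.
have [d [e [dK eK xd /eqP-> c1]]] := IH1 xK yK.
have [d' [e' [_ eK' /eqP-> ye c2]]] := IH2 yK zK.
by exists d, e'; split=> //; apply: connect_trans c1 c2.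
Qed.

Lemma district_connection K x y : x \in K -> y \in K ->
  connect (bidir (induced G K)) x y -> x != y ->
  connection G set0 K true true x y.
Proof.
move=> xK yK /connectP[p]; elim: p x xK => [|z p IH] x xK /=.
  by move=> _ ->; rewrite eqxx.
move=> /andP[/and3P[_ zK xz] zp] yE _.
have c1 : connection G set0 K true true x z by apply: (@ConnEdge _ _ _ _ _ Bi).
by case: (eqVneq z y) => [<- //|/(IH z zK zp yE) c2]; apply: (ConnCat c1 c2).
Qed.

Lemma dis_inP K X y : X \subset K ->
  reflect (exists2 x, x \in X & connect (bidir (induced G K)) x y /\ y \in K)
          (y \in dis_in G K X).
Proof.
move=> XK; rewrite inE; apply: (iffP andP).
  by move=> [yK /bigcupP[x xX]]; rewrite inE => xy; exists x.
by move=> [x xX [xy yK]]; split=> //; apply/bigcupP; exists x; rewrite ?inE.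
Qed.

Lemma connection_barren_head W U s t x h : h \in barren G W ->
  x \in an_set G W -> connection G (~: U) (an_set G W) s t x h -> t.
Proof.
move=> hB xK; have [hW _] := barrenP _ _ _ hB.
move/(connection_ancestral symG (an_an _ _) (subxx _)
       xK (subsetP (sub_an G W) _ hW)).
case: t => // /connection_end_tail-/(_ (an_set G W)).
case=> // [|z zW hz]; rewrite ?subsetIr //.
by have := barren_no_child acycG hB hz; rewrite zW.
Qed.

Lemma parametrizing_setP W :
  (W \in parametrizing_set G) <->
  W != set0 /\ pairwise_connected G setT W.
Proof.
split.
- case/imset2P=> H A; rewrite inE powersetE => /andP[/eqP barH].
  case/existsP=> v /andP[vK Hv] AT ->.
  set K := an_set G H in vK Hv.
  have HK : H \subset K by apply: sub_an.
  have vK1 : [set v] \subset K by rewrite sub1set.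
  set D := dis_in G K H.
  have DK : D \subset K by apply: subsetIl.
  have Dconn d : d \in D -> connect (bidir (induced G K)) v d.
    case/(dis_inP _ HK) => h hH [hd _].
    have /(dis_inP _ vK1)[v' /set1P -> [vh _]] := subsetP Hv _ hH.
    exact: connect_trans vh hd.
  have HD h : h \in H -> h \in D.
    move=> hH; apply/(dis_inP _ HK).
    by exists h => //; split; [exact: connect0|exact: (subsetP HK)].
  have WD w : w \in H :|: A -> exists2 d, d \in D & w = d \/ dir G w d.
    rewrite inE => /orP[/HD wD|/(subsetP AT)]; first by exists w; auto.
    rewrite in_setU => /orP[/setDP[wD _]|]; first by exists w; auto.
    by case/bigcupP=> d dD; rewrite inE; exists d; auto.
  have KW : K \subset an_set G (H :|: A) by apply/anS/subsetUl.
  split.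
    have : H != set0.
      by apply: contraTneq vK => H0; rewrite /K H0 /an_set big_set0 inE.
    by case/set0Pn=> h hH; apply/set0Pn; exists h; rewrite inE hH.
  move=> a b /WD[d dD ad] /WD[e eD be] ab.
  apply: (@connected_sub _ _ set0 K) => //; first exact: sub0set.
  have [dK eK] : d \in K /\ e \in K by split; apply: (subsetP DK).
  have de : d = e \/ connection G set0 K true true d e.
    case: (eqVneq d e) => [|de]; [by left|right].
    apply: district_connection => //; apply: connect_trans (Dconn _ eD).
    by rewrite induced_connect_sym Dconn.
  have ae : a = e \/ exists s, connection G set0 K s true a e.
    case: ad => [->|ad]; first by case: de => [|c]; [left|right; exists true].
    right; exists false; have c1 := @ConnEdge _ G set0 K _ Fwd _ ad.
    by case: de => [<- //|c]; apply: (ConnCat c1 c).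
  case: be => [be|be].
    rewrite be in ab *; case: ae => [ae|[s c]]; first by rewrite ae eqxx in ab.
    by exists s, true.
  have c1 := @ConnEdge _ G set0 K e Bwd b be.
  case: ae => [->|[s c]]; first by exists true, false.
  by exists s, false; apply: (ConnCat c c1).
- move=> [/set0Pn[w0 w0W] PW].
  set H := barren G W; set K := an_set G W.
  have HW : H \subset W by apply/subsetP=> x /barrenP[].
  have WK : W \subset K by apply: sub_an.
  have HK : H \subset K by apply: subset_trans WK.
  have [h0 h0H _] := exists_barren acycG w0W.
  have toh0 w : w \in W -> w != h0 -> exists s d,
      [/\ d \in K, (if s then d == w else dir G w d) &
          connect (bidir (induced G K)) h0 d] /\ (w \in H -> s).
    move=> wW wh0; have h0W := subsetP HW _ h0H.
    have [s [t c]] := PW _ _ wW h0W wh0.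
    have tT := connection_barren_head h0H (subsetP WK _ wW) c.
    rewrite tT setCT in c.
    have [d [e [dK _ sd /eqP eE de]]] := collider_connection_district
      (subsetP WK _ wW) (subsetP WK _ h0W) c.
    exists s, d; split; first by split; rewrite // induced_connect_sym -eE.
    move=> wH; have := connection_sym symG c; rewrite -setCT.
    exact: connection_barren_head wH (subsetP WK _ h0W).
  have KH : an_set G H = K by apply: an_barren.
  have Hh0 h : h \in H -> connect (bidir (induced G K)) h0 h.
    move=> hH; case: (eqVneq h h0) => [->|hh0]; first exact: connect0.
    have [s [d [[_ sd cd] hs]]] := toh0 _ (subsetP HW _ hH) hh0.
    by rewrite hs // in sd; rewrite -(eqP sd).
  have WHA : W = H :|: (W :\: H) by rewrite -{1}(setID W H) (setIidPr HW).
  rewrite WHA; apply: imset2_f.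
    rewrite inE /is_head KH; apply/andP; split.
      apply/eqP/setP=> h; apply/barrenP/idP=> [[]//|hH]; split=> // x xH.
      by case/barrenP: hH => _ /(_ x); apply; apply: (subsetP HW).
    apply/existsP; exists h0; rewrite (subsetP HK) //=.
    apply/subsetP=> h hH; apply/dis_inP; first by rewrite sub1set (subsetP HK).
    by exists h0; rewrite ?inE //; split; [exact: Hh0|exact: (subsetP HK)].
  rewrite powersetE; apply/subsetP=> w /setDP[wW wH].
  have wh0 : w != h0 by apply: contraNneq wH => ->.
  have [s [d [[dK sd cd] _]]] := toh0 _ wW wh0.
  have dD : d \in dis_in G K H by apply/(dis_inP _ HK); exists h0.
  rewrite /tail KH in_setU; case: s sd => [/eqP dw|wd].
    by rewrite in_setD -dw dD dw wH.
  by apply/orP; right; apply/bigcupP; exists d; rewrite // inE.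
Qed.

End ParametrizingSetConnections.

Lemma not_uniq_split (T : eqType) (s : seq T) : ~~ uniq s ->
  exists x s1 s2 s3, s = s1 ++ x :: s2 ++ x :: s3.
Proof.
elim: s => //= y s IH; rewrite negb_and negbK => /orP[|/IH].
  by case/splitPr=> s2 s3; exists y, [::], s2, s3.
by move=> [x [s1 [s2 [s3 ->]]]]; exists x, (y :: s1), s2, s3.
Qed.

Lemma map_eq_cat (T T' : Type) (f : T -> T') s s1 x s2 :
  map f s = s1 ++ x :: s2 -> exists r1 y r2,
  [/\ s = r1 ++ y :: r2, map f r1 = s1, f y = x & map f r2 = s2].
Proof.
elim: s1 s => [|z s1 IH] [|y s] //= [yz].
  by move=> ss; exists [::], y, s.
move=> /IH[r1 [y' [r2 [-> <- <- <-]]]].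
by exists (y :: r1), y', r2; rewrite /= yz.
Qed.

Section Walks.
Variables (V : finType) (G : mixed_graph V).
Hypothesis symG : symmetric (bidir G).
Implicit Types (x y z v : V) (C K : {set V}) (p q : seq (edge_kind * V)).

Lemma is_walk_cat x p q :
  is_walk G x (p ++ q) = is_walk G x p && is_walk G (last x (unzip2 p)) q.
Proof. by elim: p x => //= -[k y] p IH x /=; rewrite IH andbA. Qed.

Lemma is_open_cat C p k x q :
  is_open G C (p ++ (k, x) :: q) =
  is_open G C (rcons p (k, x)) && is_open G C ((k, x) :: q).
Proof.
elim: p => [|[k1 y] p IH] //.
rewrite cat_cons rcons_cons; case: p IH => [|[k2 z] p] IH.
  by rewrite /= andbT.
by rewrite cat_cons rcons_cons /= in IH *; rewrite IH andbA.
Qed.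

Lemma walk_connection C x k y q : is_walk G x ((k, y) :: q) ->
  is_open G C ((k, y) :: q) ->
  connection G (~: C) (an_set G C) (head_at_left k)
    (head_at_right (last k (unzip1 q))) x (last y (unzip2 q)).
Proof.
elim: q x k y => [|[k' z] q IH] x k y; first by move=> /andP[xy _] _; apply: ConnEdge.
move=> /andP[xy yq] /andP[ky qo].
apply: (ConnCat (ConnEdge _ _ xy) (IH _ _ _ yq qo)).
by case: ifP ky => // _ yC; rewrite inE.
Qed.

Lemma is_open_join C k z q k' z' q' : is_open G C ((k, z) :: q) ->
  is_open G C ((k', z') :: q') ->
  last z (unzip2 q) \in (if head_at_right (last k (unzip1 q)) && head_at_left k'
                         then an_set G C else ~: C) ->
  is_open G C (((k, z) :: q) ++ (k', z') :: q').
Proof.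
elim: q k z => [|[k1 z1] q IH] k z o o' zC.
  rewrite cat_cons cat0s; apply/andP; split; last exact: o'.
  by move: zC => /=; case: ifP => // _; rewrite inE.
case/andP: o => o1 o2; rewrite cat_cons /=; apply/andP; split=> //.
exact: IH o2 o' zC.
Qed.

Lemma connection_walk C s t x y :
  connection G (~: C) (an_set G C) s t x y -> exists k z q,
  [/\ is_walk G x ((k, z) :: q), is_open G C ((k, z) :: q),
      last z (unzip2 q) = y, head_at_left k = s &
      head_at_right (last k (unzip1 q)) = t].
Proof.
elim=> {s t x y}[x k y xy|s t s' t' x y z _ IH1 _ IH2 yC].
  by exists k, y, [::]; split=> //=; rewrite xy.
have [k [w [q [wk o le hl hr]]]] := IH1.
have [k' [w' [q' [wk' o' le' hl' hr']]]] := IH2.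
exists k, w, (q ++ (k', w') :: q'); split=> //.
- by rewrite -cat_cons is_walk_cat wk /= le.
- by rewrite -cat_cons; apply: is_open_join; rewrite // le hr hl'.
- by rewrite /unzip2 map_cat last_cat.
- by rewrite /unzip1 map_cat last_cat.
Qed.

Lemma open_walk_shorten C a b p : a != b -> is_walk G a p ->
  is_open G C p -> last a (unzip2 p) = b -> ~~ uniq (a :: unzip2 p) ->
  exists p', [/\ is_walk G a p', is_open G C p', last a (unzip2 p') = b &
                 size p' < size p].
Proof.
move=> ab wp op lp /not_uniq_split[x [s1 [s2 [s3]]]].
case: s1 => [|a' s1] /= [].
  move=> ax e; have [r1 [[k y] [r2 [pE _ /= yx _]]]] := map_eq_cat e.
  rewrite yx -ax in pE; rewrite pE in wp op lp *.
  exists r2; split.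
  - by move: wp; rewrite is_walk_cat /= => /and3P[].
  - move: op; rewrite is_open_cat => /andP[_].
    by case: (r2) => [|[k' z] r] // /andP[].
  - by rewrite -lp /unzip2 map_cat last_cat.
  - by rewrite size_cat /= addnS ltnS leq_addl.
move=> _ e; have [r1 [[k y] [r [pE _ /= yx e']]]] := map_eq_cat e.
have [r2 [[k' y'] [r3 [rE _ /= yx' _]]]] := map_eq_cat e'.
rewrite {}rE yx yx' in pE; rewrite {e e' r}pE in wp op lp *.
exists (r1 ++ (k, x) :: r3); move: wp op lp.
rewrite is_walk_cat /= is_walk_cat /= => /and5P[w1 w2 w3 w4 w5].
rewrite is_open_cat -cat_cons is_open_cat => /and3P[o1 o2 o3].
rewrite /unzip2 map_cat last_cat /= map_cat last_cat /= => lp.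
split.
- by rewrite is_walk_cat w1 /= w2.
- rewrite is_open_cat o1 /=; case: r3 o3 {lp w5} => [|[k3 z] r3] //=.
  move=> /andP[o3 o3']; rewrite o3' andbT.
  case: ifP => hk.
    have [kr kl] := andP hk; move: o3; rewrite kl andbT.
    case: ifP => // k'r _; move: o2.
    case: r2 w3 w4 => [|[k2 z2] r2] w3 w4.
      rewrite /= kr /=; case: ifP => [_ /andP[]//|hl _].
      by case: (k') hl k'r.
    rewrite rcons_cons => /andP[].
    rewrite kr /=; case: ifP => [//|hl _ o2].
    have w4' : is_walk G x ((k2, z2) :: rcons r2 (k', x)).
      by rewrite -rcons_cons -cats1 is_walk_cat w3 /= w4.
    have := walk_connection w4' o2.
    rewrite hl /unzip1 /unzip2 !map_rcons !last_rcons /= k'r.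
    case/connection_tail_an=> [|[]//]; exact: (subsetP (an_an _ _)).
  move: hk o3 o2 => /negbT; rewrite negb_and => /orP[/negPf kr|/negPf kl].
    move=> _; case: (r2) => [|[k2 z2] ?]; rewrite ?rcons_cons /= kr //=.
      by case/andP.
    by case/andP.
  by rewrite kl andbF.
- by rewrite map_cat last_cat.
- by rewrite !size_cat /= size_cat /= ltn_add2l !ltnS addnS ltnS leq_addl.
Qed.

Lemma open_walk_path C a b p : a != b -> is_walk G a p -> is_open G C p ->
  last a (unzip2 p) = b -> exists p, m_connecting G C a b p.
Proof.
move=> ab; have [n] := ubnP (size p); elim: n p => // n IH p pn wp op lp.
case: (boolP (uniq (a :: unzip2 p))) => [up|/(open_walk_shorten ab wp op lp)].
  by exists p; rewrite /m_connecting /is_path wp op up lp eqxx.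
move=> [p' [wp' op' lp' pp']]; apply: IH wp' op' lp'.
exact: leq_trans pp' pn.
Qed.

(* A collider with no descendant in C but with a directed path to a is removed
   by restarting the walk at a, against that directed path. *)
Lemma connected_reroute C K a b : a \notin C -> a != b -> an_set G C \subset K ->
  connected G (~: C) (K :|: an G a) a b -> connected G (~: C) K a b.
Proof.
move=> aC ab CK [s [t c]].
have reroute s0 t0 x y : connection G (~: C) (K :|: an G a) s0 t0 x y ->
    connection G (~: C) K s0 t0 x y \/ exists z s',
    [/\ z \notin an_set G C, connect (dir G) z a &
        connection G (~: C) K s' t0 z y].
  elim=> {s t ab c s0 t0 x y}[x k y xy|s t s' t' x y z _ IH1 c2 IH2 yK].
    by left; apply: ConnEdge.
  case: IH2 => [{}c2|[w [s'' [wC wa {}c2]]]]; last by right; exists w, s''.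
  have [yK'|[yC ya]] : y \in (if t && s' then K else ~: C) \/
      y \notin an_set G C /\ connect (dir G) y a.
    case: ifP yK => _ yK; last by left.
    move: yK; rewrite in_setU inE => /orP[]; first by left.
    case: (boolP (y \in an_set G C)) => [/(subsetP CK)|]; first by left.
    by right.
  - case: IH1 => [c1|[w [s'' [wC wa c1]]]]; first by left; apply: (ConnCat c1 c2).
    by right; exists w, s''; split=> //; apply: (ConnCat c1 c2).
  - by right; exists y, s'.
case: (reroute _ _ _ _ c) => [c'|[z [s' [zC za c']]]]; first by exists s, t.
case: (eqVneq z a) => [zaE|neq]; first by rewrite zaE in c'; exists s', t.
have zN : z \in ~: (a |: C).
  rewrite !inE negb_or neq; apply: contraNN zC; exact: (subsetP (sub_an G C)).
have aN : a \notin ~: (a |: C) by rewrite !inE eqxx.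
have [u [uN _ cu]] := connection_directed za zN aN.
have uE : u = a.
  have zu : connect (dir G) z u.
    by case: (connection_tail_an cu) => [/anP[w]|[]//]; rewrite inE.
  move: uN; rewrite !inE negbK => /orP[/eqP //|uC].
  by case/anP: zC; exists u.
rewrite uE in cu; exists true, t.
have cu' : connection G (~: C) K true false a z.
  apply: (connection_sym symG); apply: connection_sub cu; last exact: sub0set.
  by rewrite setCS subsetUr.
apply: (ConnCat cu' c'); rewrite /= inE.
apply: contraNN zC; exact: (subsetP (sub_an G C)).
Qed.

Lemma m_connecting_connected C a b : a != b -> a \notin C -> b \notin C ->
  (exists p, m_connecting G C a b p) <->
  connected G (~: C) (an_set G (C :|: [set a; b])) a b.
Proof.
move=> ab aC bC; split.
  move=> [p /andP[/and3P[wp _ /eqP lp] op]].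
  case: p wp op lp => [|[k y] q] wp op lp; first by rewrite /= in lp; rewrite lp eqxx in ab.
  rewrite /= in lp; have := walk_connection wp op; rewrite lp => c.
  exists (head_at_left k), (head_at_right (last k (unzip1 q))).
  by apply: connection_sub c => //; apply/anS/subsetUl.
move=> c.
have {}c : connected G (~: C) ((an_set G C :|: an G b) :|: an G a) a b.
  apply: connected_sub c => //; apply/subsetP=> x /anP[w].
  rewrite !inE => /orP[wC|/orP[]/eqP->] xw; last 2 first.
  - by rewrite xw orbT.
  - by rewrite xw orbT.
  by apply/orP; left; apply/orP; left; apply/anP; exists w.
have {}c := connected_reroute aC ab (subsetUl _ _) c.
have ba : b != a by rewrite eq_sym.
have [t [s c']] := connected_reroute bC ba (subxx _) (connected_sym symG c).
have [k [z [q [wq oq lq _ _]]]] := connection_walk (connection_sym symG c').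
exact: open_walk_path ab wq oq lq.
Qed.

End Walks.

(* All the connections between members of the family and the childless vertex v
   enter v through an arrowhead, so that they concatenate at v. *)
Lemma childless_bigcup_parametrizing (V : finType) (G : mixed_graph V)
    (U : {set V}) (v : V) (F : {set {set V}}) :
  is_admg G -> an_set G U \subset U -> (forall z, z \in U -> ~~ dir G v z) ->
  F != set0 ->
  (forall Z, Z \in F -> [/\ Z \in parametrizing_set G, v \in Z & Z \subset U]) ->
  \bigcup_(Z in F) Z \in parametrizing_set G.
Proof.
move=> admgG UU vU /set0Pn[Z0 Z0F] FP; set Y := \bigcup_(Z in F) Z.
have symG : symmetric (bidir G) by case: admgG.
have vY : v \in Y by apply/bigcupP; exists Z0; case: (FP _ Z0F).
apply/(parametrizing_setP admgG); split; first by apply/set0Pn; exists v.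
have tov a : a \in Y -> a != v ->
    exists s, connection G (~: setT) (an_set G Y) s true a v.
  move=> /bigcupP[Z ZF aZ] av; have [/(parametrizing_setP admgG)[_ PZ] vZ ZU] := FP _ ZF.
  have [s [t c]] := PZ _ _ aZ vZ av.
  have ZY : an_set G Z \subset an_set G Y by apply/anS/bigcup_sup.
  exists s; case: t c => c; first exact: connection_sub c.
  have [| | z zZ vz] := connection_end_tail _ (subxx _) _ c.
  - by rewrite setCT sub0set.
  - exact: (subsetP (sub_an G Z)).
  have /vU : z \in U by apply: (subsetP UU); apply: (subsetP (anS G ZU)).
  by rewrite vz.
move=> a b aY bY ab; case: (eqVneq a v) => [av|av].
  by rewrite av in ab *; rewrite eq_sym in ab;
     have [s c] := tov _ bY ab; apply/(connected_sym symG); exists s, true.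
have [s c] := tov _ aY av.
case: (eqVneq b v) => [->|/(tov _ bY)[s' c']]; first by exists s, true.
exists s, s'; apply: (ConnCat c (connection_sym symG c')).
exact: (subsetP (sub_an G Y)).
Qed.

Lemma exists_ancestral_extension (V : finType) (G : mixed_graph V)
    (U : {set V}) :
  acyclic G -> an_set G U \subset U -> U != setT -> exists v,
  [/\ v \notin U, an_set G (v |: U) \subset v |: U &
      forall z, z \in v |: U -> ~~ dir G v z].
Proof.
move=> acycG UU; rewrite -subTset => /subsetPn[v0 _ v0U].
case: (@arg_minnP _ v0 [pred v | v \notin U] (fun v => #|an G v|) v0U) => v /= vU vmin.
exists v; split=> //.
  apply/subsetP=> x /anP[w]; rewrite in_setU1 => /orP[/eqP->|wU] xw; last first.
    by rewrite in_setU1 (subsetP UU) ?orbT //; apply/anP; exists w.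
  rewrite in_setU1; case: eqVneq => //= xv; apply/negPn/negP=> /vmin.
  rewrite leqNgt => /negP[]; apply/proper_card/properP; split.
    by apply/subsetP=> y; rewrite !inE => yx; apply: connect_trans yx xw.
  exists v; rewrite !inE ?connect0 //; apply/negP=> vx.
  by rewrite (connect_antisym acycG xw vx) eqxx in xv.
move=> z; rewrite in_setU1 => /orP[/eqP->|zU]; first by rewrite dir_irrefl.
apply: contraNN vU => vz; exact: ancestral_connect UU (connect1 vz) zU.
Qed.

Section EqualParametrizingSets.
Variables (V : finType) (G1 G2 : mixed_graph V).
Hypotheses (admg1 : is_admg G1) (admg2 : is_admg G2).
Hypothesis eqS : parametrizing_set G1 = parametrizing_set G2.
Implicit Types (U W A B C : {set V}) (v a b : V).

Let sym1 : symmetric (bidir G1). Proof. by case: admg1. Qed.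
Let sym2 : symmetric (bidir G2). Proof. by case: admg2. Qed.
Let acyc1 : acyclic G1. Proof. by case: admg1. Qed.
Let acyc2 : acyclic G2. Proof. by case: admg2. Qed.

(* If some pair of W needs v as a noncollider, then every vertex of W is
   connected to v through a vertex h barren in W, where all walks end with an
   arrowhead. *)
Lemma marginal_pairwise_connected_step U W v :
  an_set G1 (v |: U) \subset v |: U ->
  (forall z, z \in v |: U -> ~~ dir G1 v z) -> v \notin U ->
  (forall Z : {set V}, Z \subset v |: U -> Z != set0 ->
    pairwise_connected G2 (v |: U) Z -> Z \in parametrizing_set G2) ->
  W \subset U -> W != set0 -> pairwise_connected G2 U W ->
  pairwise_connected G2 (v |: U) W.
Proof.
set U' := v |: U; set K := an_set G2 W => U'U' vchild vU IH WU W0 PW.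
have UU' : U \subset U' by apply: subsetUr.
have WU' : W \subset U' by apply: subset_trans UU'.
have WK : W \subset K by apply: sub_an.
have NU : ~: U = v |: ~: U'.
  by apply/setP=> x; rewrite !inE; case: (eqVneq x v) => [->|] //=; rewrite vU.
have PW' a b : a \in W -> b \in W -> a != b -> connected G2 (~: U') K a b \/
    [/\ v \in K, connected G2 (~: U') K a v & connected G2 (~: U') K v b].
  move=> aW bW ab; have [s [t c]] := PW _ _ aW bW ab.
  have {}c := connection_ancestral sym2 (an_an _ _) (subxx _)
    (subsetP WK _ aW) (subsetP WK _ bW) c.
  case: (boolP (v \in K)) => vK; last first.
    left; exists s, t; apply: connection_sub c => //.
    apply/subsetP=> x; rewrite NU !inE => /andP[/orP[/eqP->|//]].
    by rewrite (negPf vK).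
  have c' : connected G2 (v |: ~: U') K a b.
    by rewrite -NU; exists s, t; apply: connection_sub c => //; apply: subsetIl.
  by case: (connected_split c') => [|[]]; [left|right].
have [w0 w0W] := set0Pn _ W0.
have [h hB _] := exists_barren acyc2 w0W; have [hW _] := barrenP _ _ _ hB.
have hK := subsetP WK _ hW.
have hjoin a b : a \in K -> b \in K -> connected G2 (~: U') K a h ->
    connected G2 (~: U') K b h -> connected G2 (~: U') K a b.
  move=> aK bK [s [t c]] [s' [t' c']]; exists s, s'.
  have tT := connection_barren_head admg2 hB aK c.
  have t'T := connection_barren_head admg2 hB bK c'.
  by apply: (ConnCat c (connection_sym sym2 c')); rewrite tT t'T.
case: (classic (v \in K /\ connected G2 (~: U') K h v)) => [[vK hv]|nhv].
  have tov w : w \in W -> connected G2 (~: U') K w v.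
    move=> wW; case: (eqVneq w h) => [->//|wh].
    case: (PW' _ _ wW hW wh) => [wh'|[]//].
    exact: hjoin (subsetP WK _ wW) vK wh' (connected_sym sym2 hv).
  pose F := [set Z in parametrizing_set G1 |
             [&& v \in Z, Z \subset U' & Z \subset K]].
  have FP Z : Z \in F -> [/\ Z \in parametrizing_set G1, v \in Z & Z \subset U'].
    by rewrite inE => /and4P[].
  have inF w : w \in W -> exists2 Z, Z \in F & w \in Z.
    move=> wW; have vU' : v \in U' by apply: setU11.
    have [Z [wZ vZ ZU ZK PZ]] := connected_in_pairwise_connected sym2 WU'
      (subsetP WU' _ wW) vU' (tov _ wW).
    exists Z => //; rewrite inE eqS vZ ZU IH //; last by apply/set0Pn; exists v.
    apply: subset_trans ZK _; rewrite !subUset !sub1set vK subxx !andbT.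
    exact: (subsetP WK).
  have [Z0 Z0F _] := inF _ w0W.
  have F0 : F != set0 by apply/set0Pn; exists Z0.
  have := childless_bigcup_parametrizing admg1 U'U' vchild F0 FP.
  rewrite eqS => /(parametrizing_setP admg2)[_ PY] a b aW bW ab.
  have WY w : w \in W -> w \in \bigcup_(Z in F) Z.
    by move=> /inF[Z ZF wZ]; apply/bigcupP; exists Z.
  apply: connected_sub (PY _ _ (WY _ aW) (WY _ bW) ab).
    by rewrite setCT sub0set.
  by apply/an_sub/bigcupsP=> Z; rewrite inE => /and4P[].
have toh w : w \in W -> w != h -> connected G2 (~: U') K w h.
  move=> wW wh; case: (PW' _ _ wW hW wh) => // -[vK _ vh].
  by case: nhv; split=> //; apply: connected_sym.
move=> a b aW bW ab; case: (eqVneq a h) => [ah|ah].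
  rewrite ah in ab *; apply: (connected_sym sym2); apply: toh => //.
  by rewrite eq_sym.
case: (eqVneq b h) => [->|bh]; first exact: toh.
by apply: hjoin; [apply: (subsetP WK)|apply: (subsetP WK)|apply: toh|apply: toh].
Qed.

Lemma marginal_parametrizing_set U W : an_set G1 U \subset U ->
  W \subset U -> W != set0 -> pairwise_connected G2 U W ->
  W \in parametrizing_set G2.
Proof.
have [n] := ubnP #|~: U|; elim: n U W => // n IH U W Un UU WU W0 PW.
case: (eqVneq U setT) => [UT|UT].
  by apply/(parametrizing_setP admg2); rewrite -UT.
have [v [vU U'U' vchild]] := exists_ancestral_extension acyc1 UU UT.
have U'n : #|~: (v |: U)| < n.
  rewrite ltnS in Un; apply: leq_trans Un; apply/proper_card/properP; split.
    by rewrite setCS subsetUr.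
  by exists v; rewrite !inE ?eqxx.
apply: (IH (v |: U)) => //; first exact: subset_trans WU (subsetUr _ _).
apply: marginal_pairwise_connected_step => // Z ZU Z0 PZ.
exact: (IH (v |: U)).
Qed.

Lemma connected_transfer C a b : a != b -> a \notin C ->
  b \notin C ->
  connected G2 (~: C) (an_set G2 (C :|: [set a; b])) a b ->
  connected G1 (~: C) (an_set G1 (C :|: [set a; b])) a b.
Proof.
set D := C :|: [set a; b]; set U := an_set G1 D => ab aC bC.
have UU : an_set G1 U \subset U by apply: an_an.
have DU : D \subset U by apply: sub_an.
have CU : C \subset U by apply: subset_trans DU; apply: subsetUl.
have CN : ~: C = (U :\: C) :|: ~: U.
  apply/setP=> x; rewrite !inE; case: (boolP (x \in C)) => [/(subsetP CU) ->|] //=.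
  by rewrite orbN.
have main (M : {set V}) x y : M \subset U :\: C -> x \in U -> y \in U -> x != y ->
    connected G2 (M :|: ~: U) (an_set G2 D) x y -> connected G1 (~: C) U x y.
  have [n] := ubnP #|M|; elim: n M x y => // n IH M x y Mn MU xU yU xy.
  case: (set_0Vmem M) => [->|[v vM]].
    rewrite set0U => c.
    have [Y [xY yY YU _ PY]] :=
      connected_in_pairwise_connected sym2 DU xU yU c.
    have : Y \in parametrizing_set G2.
      apply: marginal_parametrizing_set PY => //.
      by apply/set0Pn; exists x.
    rewrite -eqS => /(parametrizing_setP admg1)[_ PY1].
    apply: connected_sub (PY1 _ _ xY yY xy); first by rewrite setCT sub0set.
    exact: an_sub.
  have Mv : #|M :\ v| < n by rewrite (cardsD1 v M) vM in Mn.
  have MvU : M :\ v \subset U :\: C by apply: subset_trans MU; apply: subD1set.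
  have [vU vC] := setDP (subsetP MU _ vM).
  rewrite -(setD1K vM) -setUA => c; case: (connected_split c) => [{}c|[c1 c2]].
    exact: IH c.
  case: (eqVneq x v) => [xv|xv].
    by apply: (IH (M :\ v)) => //; rewrite xv.
  case: (eqVneq v y) => [vy|vy].
    by apply: (IH (M :\ v)) => //; rewrite -vy.
  apply: (@connected_cat _ _ _ _ _ v) => //; first by rewrite inE.
    exact: IH c1.
  exact: IH c2.
rewrite CN => c; rewrite -CN; apply: main c => //.
  by apply: (subsetP DU); rewrite !inE eqxx orbT.
by apply: (subsetP DU); rewrite !inE eqxx !orbT.
Qed.

Lemma m_separated_transfer A B C :
  m_separated G1 A B C -> m_separated G2 A B C.
Proof.
move=> [A0 B0 dABC sepG1]; split=> // a b aA bB.
have /and3P[dAB dAC dBC] := dABC.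
have aC : a \notin C by rewrite (disjointFr dAC).
have bC : b \notin C by rewrite (disjointFr dBC).
have ab : a != b by apply: contraTneq aA => ->; rewrite (disjointFl dAB).
move/(m_connecting_connected sym2 ab aC bC)/(connected_transfer ab aC bC).
by move/(m_connecting_connected sym1 ab aC bC); apply: sepG1.
Qed.

End EqualParametrizingSets.

Lemma m_separated1 (V : finType) (G : mixed_graph V) (C : {set V}) a b :
  symmetric (bidir G) -> a != b -> a \notin C -> b \notin C ->
  m_separated G [set a] [set b] C <->
  ~ connected G (~: C) (an_set G (C :|: [set a; b])) a b.
Proof.
move=> symG ab aC bC; have mcP := m_connecting_connected symG ab aC bC.
split=> [[_ _ _ sepG] /mcP|nc].
  by apply: sepG; rewrite inE.
split=> [||| x y /set1P -> /set1P -> /mcP //].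
- by apply/set0Pn; exists a; rewrite inE.
- by apply/set0Pn; exists b; rewrite inE.
- by rewrite !disjoints1 inE ab aC bC.
Qed.

Lemma markov_parametrizing_subset (V : finType) (G1 G2 : mixed_graph V) :
  is_admg G1 -> is_admg G2 -> markov_equivalent G1 G2 ->
  parametrizing_set G1 \subset parametrizing_set G2.
Proof.
move=> admg1 admg2 eqM; have [sym1 _ _] := admg1; have [sym2 _ _] := admg2.
apply/subsetP=> W /(parametrizing_setP admg1)[W0 PW].
apply/(parametrizing_setP admg2); split=> // a b aW bW ab.
set K := an_set G2 W; have WK : W \subset K by apply: sub_an.
pose C := K :\: [set a; b].
have aC : a \notin C by rewrite !inE eqxx.
have bC : b \notin C by rewrite !inE eqxx orbT.
have CE : C :|: [set a; b] = K.
  have abK : [set a; b] \subset K by rewrite subUset !sub1set !(subsetP WK).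
  by rewrite -[RHS](setID K [set a; b]) (setIidPr abK) setUC.
have c1 : connected G1 (~: C) (an_set G1 (C :|: [set a; b])) a b.
  apply: connected_sub (PW _ _ aW bW ab); first by rewrite setCT sub0set.
  by rewrite CE; apply: anS.
have c2 : connected G2 (~: C) (an_set G2 K) a b.
  rewrite -CE; apply: NNPP => /(m_separated1 sym2 ab aC bC)/eqM.
  by move/(m_separated1 sym1 ab aC bC).
have [s [t c]] := c2.
have {}c := connection_sub (subxx _) (an_an _ _) c.
have {}c := connection_ancestral sym2 (an_an _ _) (subxx _)
  (subsetP WK _ aW) (subsetP WK _ bW) c.
have c3 : connected G2 (a |: (b |: set0)) K a b.
  exists s, t; apply: connection_sub c => //.
  by apply/subsetP=> x; rewrite !inE; case: (x \in K); rewrite ?andbF ?andbT ?orbF ?negbK.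
rewrite setCT; case: (connected_split c3) => [{}c3|[_ {}c3]];
  by case: (connected_split c3) => [|[]].
Qed.

Theorem theorem3p2 (V : finType) (G1 G2 : mixed_graph V) (magG1 : is_mag G1) (magG2 : is_mag G2) :
  markov_equivalent G1 G2 <-> parametrizing_set G1 = parametrizing_set G2.
Proof.
have [admg1 _ _] := magG1; have [admg2 _ _] := magG2.
split=> [eqM|eqS].
  apply/eqP; rewrite eqEsubset !markov_parametrizing_subset // => A B C.
  exact: iff_sym.
move=> A B C; split; exact: m_separated_transfer.
Qed.
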